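(* Let $n\ge 1$. The semigroup $\mathcal{P}_n$ has an $\mathcal{H}$-class-preserving involution matching $\alpha\mapsto\alpha'$ which on the non-constant mappings is (well) defined by the rule: if $\alpha=\Phi(K,R,i,k)$ then $\alpha'=\Phi(R,K,-ki,k)$.
   Context: Let $[n]=\{0,1,\dots,n-1\}$; $\mathcal{T}_n$ is the full transformation semigroup on $[n]$, with maps written on the right and composed left to right. A sequence $(a_0,\dots,a_t)$ from $[n]$ is cyclic if there is at most one subscript $i$ with $a_i>a_{i+1}$ (taking $t+1=0$), and anti-cyclic if its reverse is cyclic. $\mathcal{OP}_n$ (resp. $\mathcal{OR}_n$) is the set of $\alpha\in\mathcal{T}_n$ whose image list $(0\alpha,1\alpha,\dots,(n-1)\alpha)$ is cyclic (resp. anti-cyclic). $\mathcal{P}_n=\mathcal{OP}_n\cup\mathcal{OR}_n$ is a regular submonoid of $\mathcal{T}_n$. Coordinates: let $2\le t\le n$, let $K=\{a_0<a_1<\dots<a_{t-1}\}$ and $R=\{r_0<r_1<\dots<r_{t-1}\}$ be $t$-subsets of $[n]$, let $i$ be an integer modulo $t$ and $k\in\{1,-1\}$. For $0\le j\le t-1$ let $K_j$ be the cyclic interval $\{a_j,a_j+1,\dots,a_{j+1}-1\}$ (entries modulo $n$, subscripts modulo $t$); these sets partition $[n]$. $\Phi(K,R,i,k)$ is the mapping $\alpha$ with $x\alpha=r_{i+kj}$ for all $x\in K_j$ (subscripts modulo $t$). Each $\Phi(K,R,i,k)$ is a member of $\mathcal{P}_n$ of rank $t$, and every non-constant member of $\mathcal{P}_n$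 is of this form. $V(a)$ denotes the set of inverses of $a$: those $b$ with $aba=a$, $bab=b$. An involution matching of a semigroup $S$ is a map $a\mapsto a'$ of $S$ to itself with $a'\in V(a)$ and $(a')'=a$ for all $a\in S$; it is $\mathcal{H}$-class-preserving if $a\,\mathcal{H}\,b$ implies $a'\,\mathcal{H}\,b'$, where $\mathcal{H}$ is Green's relation. *)

(* Defs.v *)
From HB Require Import structures.
From mathcomp Require Import all_boot all_order all_algebra.
From mathcomp Require Import zify.

Set Implicit Arguments.
Unset Strict Implicit.
Unset Printing Implicit Defensive.

Local Open Scope nat_scope.

Section Semigroup.
Variable S : semigroupType.
Implicit Types a b : S.
Local Open Scope group_scope.

Definition inverse_of a b : Prop := a * b * a = a /\ b * a * b = b.

Definition left_ideal1 a (x : S) : Prop := x = a \/ exists s : S, x = s * a.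
Definition right_ideal1 a (x : S) : Prop := x = a \/ exists s : S, x = a * s.

Definition greenL a b : Prop := forall x, left_ideal1 a x <-> left_ideal1 b x.
Definition greenR a b : Prop := forall x, right_ideal1 a x <-> right_ideal1 b x.
Definition greenH a b : Prop := greenL a b /\ greenR a b.

Definition involution_matching (m : S -> S) : Prop :=
  forall a, inverse_of a (m a) /\ m (m a) = a.

Definition H_class_preserving (m : S -> S) : Prop :=
  forall a b, greenH a b -> greenH (m a) (m b).

End Semigroup.

(* An alias of the finite function type, so that its product is composition
   and not the pointwise product. *)
Definition transf (n : nat) : Type := {ffun 'I_n -> 'I_n}.
HB.instance Definition _ n := Finite.on (transf n).

Section TransfMonoid.
Variable n : nat.
Implicit Types f g h : transf n.

(* Maps act on the right: x (f g) = (x f) g. *)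
Definition transf_mul f g : transf n := [ffun x => g (f x)].
Definition transf_one : transf n := [ffun x => x].

Lemma transf_mulA : associative transf_mul.
Proof. by move=> f g h; apply/ffunP=> x; rewrite !ffunE. Qed.
Lemma transf_mul1 : left_id transf_one transf_mul.
Proof. by move=> f; apply/ffunP=> x; rewrite !ffunE. Qed.
Lemma transf_1mul : right_id transf_one transf_mul.
Proof. by move=> f; apply/ffunP=> x; rewrite !ffunE. Qed.

HB.instance Definition _ :=
  isMonoid.Build (transf n) transf_mulA transf_mul1 transf_1mul.

Lemma transf_mulE f g x : (f * g)%g x = g (f x).
Proof. by rewrite ffunE. Qed.
Lemma transf_1E x : (1%g : transf n) x = x.
Proof. by rewrite ffunE. Qed.

End TransfMonoid.

(* [ordS] is the successor modulo the length, so the last entry is compared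
   with the first one. *)
Definition cyclic n t (a : t.-tuple 'I_n) : bool :=
  #|[set i : 'I_t | tnth a i > tnth a (ordS i)]| <= 1.
Definition anticyclic n t (a : t.-tuple 'I_n) : bool := cyclic (rev_tuple a).

Definition image_list n (f : transf n) : n.-tuple 'I_n := [tuple f x | x < n].

Definition OP n : {pred transf n} := [pred f | cyclic (image_list f)].
Definition OR n : {pred transf n} := [pred f | anticyclic (image_list f)].
Arguments OP n : clear implicits.
Arguments OR n : clear implicits.

Definition orient n : {pred transf n} :=
  [pred f | (f \in OP n) || (f \in OR n)].
Arguments orient n : clear implicits.

Section Closure.
Variable n : nat.
Implicit Types f g : transf n.

Definition cyc4 (w x y z : nat) : bool :=
  (x < w) + (y < x) + (z < y) + (w < z) <= 1.

Definition preserves4 f : Prop := forall w x y z : 'I_n,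
  w <= x -> x <= y -> y <= z -> cyc4 (f w) (f x) (f y) (f z).
Definition reverses4 f : Prop := forall w x y z : 'I_n,
  w <= x -> x <= y -> y <= z -> cyc4 (f z) (f y) (f x) (f w).

Lemma descent (g : nat -> nat) x y :
  x <= y -> g y < g x -> exists2 i, x <= i < y & g i.+1 < g i.
Proof.
elim: y => [|y IH] lexy ltg.
  by move: ltg; (have -> : x = 0 by lia); rewrite ltnn.
have [xSy|ltxy] : x = y.+1 \/ x <= y by lia.
  by subst x; lia.
have [lt_y|ge_y] := ltnP (g y.+1) (g y); first by exists y => //; lia.
have [|i iP gi] := IH ltxy; first by lia.
by exists i => //; lia.
Qed.

Lemma OP_preserves4 f : f \in OP n -> preserves4 f.
Proof.
rewrite inE => /card_le1_eqP cf w x y z wx xy yz.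
have n0 : 0 < n by apply: leq_ltn_trans (ltn_ord w).
pose g m := val (f (Ordinal (ltn_pmod m n0))).
have gE (i : 'I_n) : g i = f i.
  by congr (val (f _)); apply: val_inj; rewrite /= modn_small.
have gEn : g (w + n) = f w.
  by congr (val (f _)); apply: val_inj; rewrite /= modnDr modn_small.
have eqd i j : g i.+1 < g i -> g j.+1 < g j -> i = j %[mod n].
  have gS k : g k.+1 < g k ->
      Ordinal (ltn_pmod k n0)
        \in [set i | tnth (image_list f) i > tnth (image_list f) (ordS i)].
    rewrite inE !tnth_mktuple /g.
    have -> // : ordS (Ordinal (ltn_pmod k n0)) = Ordinal (ltn_pmod k.+1 n0).
    by apply: val_inj; rewrite /= -addn1 modnDml addn1.
  by move=> /gS di /gS dj; have [] := cf _ _ di dj.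
have sep i j : g i.+1 < g i -> g j.+1 < g j -> i < j -> j < i + n -> False.
  move=> di dj lt1 lt2; have /eqP := eqd _ _ dj di.
  rewrite eqn_mod_dvd 1?ltnW // => /dvdnP[q]; have := leq0n (q * n); case: q => [|q]; rewrite ?mulSn; lia.
have zn := ltn_ord z.
have D1 : f x < f w -> exists2 i, w <= i < x & g i.+1 < g i.
  by rewrite -!gE; apply: descent.
have D2 : f y < f x -> exists2 i, x <= i < y & g i.+1 < g i.
  by rewrite -!gE; apply: descent.
have D3 : f z < f y -> exists2 i, y <= i < z & g i.+1 < g i.
  by rewrite -!gE; apply: descent.
have D4 : f w < f z -> exists2 i, z <= i < w + n & g i.+1 < g i.
  by rewrite -gEn -(gE z); apply: descent; apply: ltnW; exact: ltn_addl.
rewrite /cyc4.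
case: (ltnP (f x) (f w)) D1 => [_ /(_ isT)[i1 i1P d1]|_ _];
case: (ltnP (f y) (f x)) D2 => [_ /(_ isT)[i2 i2P d2]|_ _];
case: (ltnP (f z) (f y)) D3 => [_ /(_ isT)[i3 i3P d3]|_ _];
case: (ltnP (f w) (f z)) D4 => [_ /(_ isT)[i4 i4P d4]|_ _] //;
by first [case: (sep _ _ d1 d2); lia | case: (sep _ _ d1 d3); lia
        | case: (sep _ _ d1 d4); lia | case: (sep _ _ d2 d3); lia
        | case: (sep _ _ d2 d4); lia | case: (sep _ _ d3 d4); lia].
Qed.

Lemma preserves4_OP f : preserves4 f -> f \in OP n.
Proof.
move=> pf; rewrite inE; apply/card_le1_eqP => i j.
rewrite !inE !tnth_mktuple => di dj.
wlog lt_ij : i j di dj / i < j.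
  move=> IH; case: (ltngtP i j) => [|ji|/val_inj //]; first exact: IH.
  by rewrite (IH j i).
have Si : val (ordS i) = i.+1 by rewrite /= modn_small //; have := ltn_ord j; lia.
have [jn|jn] : j.+1 = n \/ j.+1 < n by have := ltn_ord j; lia.
  have Sj : val (ordS j) = 0 by rewrite /= jn modnn.
  by have := pf (ordS j) i (ordS i) j; rewrite Sj Si /cyc4; lia.
have Sj : val (ordS j) = j.+1 by rewrite /= modn_small.
by have := pf i (ordS i) j (ordS j); rewrite Sj Si /cyc4; lia.
Qed.

Definition reversal : transf n := [ffun i => rev_ord i].

Lemma tnth_rev_tuple (T : Type) m (t : m.-tuple T) i :
  tnth (rev_tuple t) i = tnth t (rev_ord i).
Proof.
have x0 := tnth t i.
by rewrite !(tnth_nth x0) /= nth_rev ?size_tuple.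
Qed.

Lemma OR_reversal f : (f \in OR n) = ((reversal * f)%g \in OP n).
Proof.
rewrite !inE /anticyclic; congr cyclic; apply: eq_from_tnth => i.
by rewrite tnth_rev_tuple !tnth_mktuple transf_mulE ffunE.
Qed.

Lemma ORP f : f \in OR n <-> reverses4 f.
Proof.
have revE g (i : 'I_n) : (reversal * g)%g i = g (rev_ord i).
  by rewrite transf_mulE ffunE.
rewrite OR_reversal; split=> [/OP_preserves4 pf|rf].
- move=> w x y z wx xy yz.
  have := pf (rev_ord z) (rev_ord y) (rev_ord x) (rev_ord w).
  by rewrite !revE !rev_ordK /=; apply; lia.
- apply: preserves4_OP => w x y z wx xy yz; rewrite !revE.
  by apply: rf => /=; lia.
Qed.

Lemma OPP f : f \in OP n <-> preserves4 f.
Proof. by split=> [/OP_preserves4|/preserves4_OP]. Qed.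

Lemma cyc4_rot w x y z : cyc4 w x y z = cyc4 x y z w.
Proof. by rewrite /cyc4; lia. Qed.

Lemma cyc4_sorted w x y z : cyc4 w x y z ->
  [\/ [/\ w <= x, x <= y & y <= z], [/\ x <= y, y <= z & z <= w],
      [/\ y <= z, z <= w & w <= x] | [/\ z <= w, w <= x & x <= y]].
Proof.
rewrite /cyc4 => c.
have [] : (w <= x /\ x <= y /\ y <= z) \/ (x <= y /\ y <= z /\ z <= w) \/
          (y <= z /\ z <= w /\ w <= x) \/ (z <= w /\ w <= x /\ x <= y) by lia.
  by move=> [? [? ?]]; apply: Or41.
by move=> [[? [? ?]]|[[? [? ?]]|[? [? ?]]]];
  [apply: Or42 | apply: Or43 | apply: Or44].
Qed.

Lemma preserves4_cyc4 f (w x y z : 'I_n) :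
  preserves4 f -> cyc4 w x y z -> cyc4 (f w) (f x) (f y) (f z).
Proof.
move=> pf /cyc4_sorted[] [h1 h2 h3]; first exact: pf.
- by rewrite cyc4_rot; apply: pf.
- by rewrite 2!cyc4_rot; apply: pf.
- by rewrite 3!cyc4_rot; apply: pf.
Qed.

Lemma reverses4_cyc4 f (w x y z : 'I_n) :
  reverses4 f -> cyc4 w x y z -> cyc4 (f z) (f y) (f x) (f w).
Proof.
move=> rf /cyc4_sorted[] [h1 h2 h3]; first exact: rf.
- by rewrite 3!cyc4_rot; apply: rf.
- by rewrite 2!cyc4_rot; apply: rf.
- by rewrite cyc4_rot; apply: rf.
Qed.

Lemma orient_monoid_closed : monoid_closed (orient n).
Proof.
split.
  by rewrite inE; apply/orP; left; apply/OPP => w x y z;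
    rewrite !transf_1E /cyc4; lia.
move=> f g; rewrite !inE -!/(_ \in OP n) -!/(_ \in OR n).
move=> /orP[/OPP|/ORP] pf /orP[/OPP|/ORP] pg.
- apply/orP; left; apply/OPP => w x y z *; rewrite !transf_mulE.
  by apply: preserves4_cyc4; last exact: pf.
- apply/orP; right; apply/ORP => w x y z *; rewrite !transf_mulE.
  by apply: reverses4_cyc4; last exact: pf.
- apply/orP; right; apply/ORP => w x y z *; rewrite !transf_mulE.
  by apply: preserves4_cyc4; last exact: pf.
- apply/orP; left; apply/OPP => w x y z *; rewrite !transf_mulE.
  by apply: reverses4_cyc4; last exact: pf.
Qed.

End Closure.

Record Pn (n : nat) := MkPn { Pn_val : transf n; Pn_valP : Pn_val \in orient n }.

HB.instance Definition _ n := [isSub for @Pn_val n].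
HB.instance Definition _ n := [Finite of Pn n by <:].
HB.instance Definition _ n :=
  SubChoice_isSubMonoid.Build (transf n) (mem (orient n)) (Pn n)
    (@orient_monoid_closed n).

Lemma Pn_mulE n (f g : Pn n) x : Pn_val (f * g)%g x = Pn_val g (Pn_val f x).
Proof. by rewrite -transf_mulE; congr fun_of_fin; exact: (valM f g). Qed.

Section Coordinates.
Variable n : nat.
Implicit Types (K R : {set 'I_n}) (a b x : 'I_n) (i j k : int).

(* The entry a_j of K = {a_0 < ... < a_(t-1)}, with j read modulo t = #|K|;
   [enum K] lists K in increasing order.  The default x0 is never reached when
   K is nonempty. *)
Definition entry x0 K j : 'I_n := nth x0 (enum K) `|(j %% #|K|%:Z)%Z|%N.

(* The cyclic interval {a, a+1, ..., b-1} modulo n, for a != b. *)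
Definition cyclic_interval a b : {set 'I_n} :=
  [set x : 'I_n | (((x%:Z - a%:Z) %% n)%Z < ((b%:Z - a%:Z) %% n)%Z)%R].

(* x \in K_j, where K_j runs from a_j up to, but excluding, a_(j+1). *)
Definition in_block K j x : bool :=
  x \in cyclic_interval (entry x K j) (entry x K (j + 1)%R).

(* By [block_cover] below the default x is not used when #|K| >= 2. *)
Definition Phi K R i k : transf n :=
  [ffun x => if [pick j : 'I_#|K| | in_block K (val j)%:Z x] is Some j
             then entry x R (i + k * (val j)%:Z)%R else x].

Let e K (m : nat) : nat := nth 0 (map val (enum K)) m.

Lemma size_map_enum K : size (map val (enum K)) = #|K|.
Proof. by rewrite size_map -cardE. Qed.

Lemma e_lt K m p : m < p -> p < #|K| -> e K m < e K p.
Proof.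
move=> mp pK; have srt : sorted ltn (map val (enum K)).
  rewrite sorted_map {1}/enum_mem; apply: sorted_filter; first exact: ltn_trans.
  by rewrite -enumT -sorted_map val_enum_ord iota_ltn_sorted.
by apply: (sorted_ltn_nth ltn_trans) => //; rewrite inE size_map_enum // (ltn_trans mp).
Qed.

Lemma entryE x0 K (m : nat) : m < #|K| -> entry x0 K m%:Z = e K m :> nat.
Proof.
move=> mK; rewrite /entry modz_nat absz_nat modn_small // /e.
by rewrite (nth_map x0) // -cardE.
Qed.

Lemma entry0E x0 K : 0 < #|K| -> entry x0 K #|K|%:Z = e K 0 :> nat.
Proof.
by move=> K0; rewrite /entry modzz absz_nat /e (nth_map x0) // -cardE.
Qed.

Lemma modz_sub a x :
  ((Posz x - Posz a)%R %% n)%Z = Posz (if a <= x then x - a else x + n - a).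
Proof.
have xn := ltn_ord x; have an := ltn_ord a; case: ifP => ax.
  rewrite (_ : (_ - _)%R = Posz (x - a)); last by lia.
  by rewrite modz_nat modn_small //; lia.
rewrite -modzDr (_ : (_ + _)%R = Posz (x + n - a)); last by lia.
by rewrite modz_nat modn_small //; lia.
Qed.

Lemma in_blockE K (j : nat) x : 2 <= #|K| -> j < #|K| ->
  in_block K j%:Z x = if j.+1 < #|K| then e K j <= x < e K j.+1
                      else (x < e K 0) || (e K j <= x).
Proof.
move=> K2 jK; rewrite /in_block inE !modz_sub (_ : (Posz j + 1)%R = Posz j.+1); last by lia.
have xn := ltn_ord x.
have K0 : 0 < #|K| by exact: ltnW K2.
have ejn : e K j < n by rewrite -(entryE x) ?ltn_ord.
have e0n : e K 0 < n by rewrite -(entryE x) ?ltn_ord.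
rewrite entryE //; case: (ltnP j.+1 #|K|) => jS.
- have lt := e_lt (ltnSn j) jS.
  have eSn : e K j.+1 < n by rewrite -(entryE x) ?ltn_ord.
  by rewrite entryE //; do !case: ifP; lia.
- have -> : j.+1 = #|K| by lia.
  have lt : e K 0 < e K j by apply: e_lt => //; lia.
  by rewrite entry0E //; do !case: ifP; lia.
Qed.

Lemma block_cover K x : 2 <= #|K| -> exists j : 'I_#|K|, in_block K (val j)%:Z x.
Proof.
move=> K2; have K1 : 0 < #|K| by exact: ltnW K2.
have [x0|x0] := ltnP x (e K 0).
  have h : #|K|.-1 < #|K| by rewrite prednK.
  by exists (Ordinal h); rewrite in_blockE //= prednK // ltnn x0.
pose P m := (m < #|K|) && (e K m <= x).
have exP : exists m, P m by exists 0; rewrite /P K1.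
have ubP m : P m -> m <= #|K| by move=> /andP[/ltnW].
case: (ex_maxnP exP ubP) => m /andP[mK em] mmax.
exists (Ordinal mK); rewrite in_blockE //=; case: ifP => [mS|_].
  rewrite em /= ltnNge; apply/negP => le.
  by have := mmax m.+1; rewrite /P mS le ltnn => /(_ isT).
by rewrite em orbT.
Qed.

Lemma block_uniq K x (i j : nat) : 2 <= #|K| -> i < #|K| -> j < #|K| ->
  in_block K i%:Z x -> in_block K j%:Z x -> i = j.
Proof.
move=> K2; wlog lt_ij : i j / i < j.
  move=> IH iK jK bi bj; case: (ltngtP i j) => // ij; first exact: IH.
  by apply/esym/IH.
move=> iK jK; rewrite !in_blockE //.
have mono p q : p <= q -> q < #|K| -> e K p <= e K q.
  by rewrite leq_eqVlt => /orP[/eqP->|pq qK] //; exact/ltnW/e_lt.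
have iS : i.+1 < #|K| by exact: leq_ltn_trans jK.
have h1 := mono _ _ lt_ij jK; have h2 := mono 0 i (leq0n _) iK.
by rewrite iS; case: ifP => _; lia.
Qed.

Lemma PhiE K R i k x (j : nat) : 2 <= #|K| -> j < #|K| -> in_block K j%:Z x ->
  Phi K R i k x = entry x R (i + k * j%:Z)%R.
Proof.
move=> K2 jK bj; rewrite /Phi ffunE; case: pickP => [j' bj'|/(_ (Ordinal jK))].
  by congr (entry _ _ (_ + _ * Posz _)%R); apply: (block_uniq K2 _ jK bj' bj); exact: ltn_ord.
by rewrite /= bj.
Qed.

(* The index i is any integer: [Phi] only depends on its class modulo t. *)
Definition coordinates K R k : Prop :=
  exists t : nat, [/\ 2 <= t, t <= n, #|K| = t, #|R| = t & k = 1%R \/ k = (-1)%R].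

End Coordinates.

(* Main.v *)
(* [alpha'] is the unique inverse of [alpha] whose image is the set K of
   initial points of the kernel blocks of [alpha], whose own set of initial
   points is the image R of [alpha], and for which [alpha alpha'] and
   [alpha' alpha] are the retractions Phi(K,K,0,1) and Phi(R,R,0,1).  This
   description does not mention i and k, is symmetric in [alpha] and [alpha'],
   and gives equal idempotents [alpha alpha'], and equal [alpha' alpha], for all
   members of an H-class; hence well-definedness, the involution property and
   preservation of H-classes.  Constant maps have no such inverse and are their
   own partners.

   A non-constant [alpha] in P_n is injective on K: two initial points with the
   same value would force two descents.  So alpha induces an injection
   m : Z_t -> Z_t that preserves or reverses the cyclic order, and then
   m_j - m_0 (respectively m_0 - m_j) modulo t is strictly increasing in j < t,
   hence equal to j. *)
Require Import Defs.
From HB Require Import structures.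
From mathcomp Require Import all_boot all_order all_algebra.
From mathcomp Require Import zify ring.

Set Implicit Arguments.
Unset Strict Implicit.
Unset Printing Implicit Defensive.

Import Order.TTheory GRing.Theory Num.Theory.
Local Open Scope nat_scope.

(** * Injections of residues that preserve or reverse the cyclic order *)

Lemma cyc4_translation t (m : nat -> nat) :
    (forall j, j < t -> m j < t) ->
    (forall i j, i < j -> j < t -> m i != m j) ->
    (forall w x y z, w <= x -> x <= y -> y <= z -> z < t ->
       cyc4 (m w) (m x) (m y) (m z)) ->
  forall j, j < t -> m 0 + j = m j %[mod t].
Proof.
move=> m_lt m_inj m_cyc.
(* [g j] is the residue of m_j - m_0 in [0,t), the clockwise distance from m_0. *)
pose g j := if m 0 <= m j then m j - m 0 else m j + t - m 0.
have g_lt j : j < t -> g j < t.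
  move=> jt; have := m_lt _ jt; have := m_lt 0 (leq_ltn_trans (leq0n _) jt).
  by rewrite /g; case: ifP; lia.
have g_mono i j : i < j -> j < t -> g i < g j.
  move=> ij jt; have := m_lt _ jt; have := m_lt i (ltn_trans ij jt).
  have := m_lt 0 (leq_ltn_trans (leq0n _) jt).
  (* Repeating j turns the four-point condition into the three-point one on 0, i, j. *)
  have := m_inj _ _ ij jt; have := m_cyc 0 i j j (leq0n _) (ltnW ij) (leqnn _) jt.
  have := m_inj 0 j (leq_ltn_trans (leq0n _) ij) jt.
  by rewrite /g /cyc4; do !case: ifP; lia.
have g_ge j : j < t -> j <= g j.
  elim: j => // j IH jt; apply: leq_ltn_trans (IH (ltnW jt)) (g_mono _ _ _ jt).
  exact: ltnSn.
(* The d later values of g must still fit below t; with [g_ge] this pins [g j] to j. *)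
have g_le d j : j + d.+1 = t -> g j + d < t.
  elim: d j => [|d IH] j jd; first by rewrite addn0; apply: g_lt; lia.
  have := IH j.+1; have := g_mono j j.+1 (ltnSn j); lia.
move=> j jt; have gj : g j = j.
  by have := g_ge _ jt; have := g_le (t - j).-1 j; lia.
have := m_lt 0 (leq_ltn_trans (leq0n _) jt); move: gj; rewrite /g; case: ifP => m0 gj mj.
  by rewrite (_ : m 0 + j = m j) //; lia.
by rewrite (_ : m 0 + j = m j + t) ?modnDr //; lia.
Qed.

(** The flip u -> t-1-u reverses the cyclic order, so the translation case applies to
    [t.-1 - m j]. *)
Lemma cyc4_reflection t (m : nat -> nat) :
    (forall j, j < t -> m j < t) ->
    (forall i j, i < j -> j < t -> m i != m j) ->
    (forall w x y z, w <= x -> x <= y -> y <= z -> z < t ->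
       cyc4 (m z) (m y) (m x) (m w)) ->
  forall j, j < t -> m j + j = m 0 %[mod t].
Proof.
move=> m_lt m_inj m_cyc j jt.
have t0 : 0 < t by lia.
have h : (t.-1 - m 0) + j = t.-1 - m j %[mod t].
  apply: (@cyc4_translation t (fun j => t.-1 - m j)) => //=
    [i it|i k ik kt|w x y z wx xy yz zt].
  - by lia.
  - by have := m_inj _ _ ik kt; have := m_lt i; have := m_lt k; lia.
  - have := m_cyc _ _ _ _ wx xy yz zt.
    have yt := leq_ltn_trans yz zt; have xt := leq_ltn_trans xy yt.
    have := m_lt _ (leq_ltn_trans wx xt); have := m_lt _ xt.
    have := m_lt _ yt; have := m_lt _ zt.
    by rewrite /cyc4; do 4!case: ltnP; lia.
(* Adding [m 0 + m j] to both sides removes the truncated subtractions. *)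
have : (t.-1 - m 0) + j + (m 0 + m j) = t.-1 - m j + (m 0 + m j) %[mod t].
  by rewrite -modnDml h modnDml.
have := m_lt 0 t0; have := m_lt j jt => ? ?.
rewrite (_ : _ + (_ + _) = m j + j + t.-1); last lia.
rewrite (_ : t.-1 - _ + (_ + _) = m 0 + t.-1); last lia.
by move/eqP; rewrite eqn_modDr => /eqP.
Qed.

Lemma cyc4_addm t i w x y z : i < t -> w < t -> x < t -> y < t -> z < t ->
  cyc4 w x y z ->
  cyc4 ((i + w) %% t) ((i + x) %% t) ((i + y) %% t) ((i + z) %% t).
Proof.
move=> it; have mE u : u < t -> (i + u) %% t = if i + u < t then i + u else i + u - t.
  move=> ut; case: ifP => iu; first by rewrite modn_small.
  by rewrite -[in LHS](@subnK t (i + u)) 1?modnDr ?modn_small //; lia.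
by move=> wt xt yt zt; rewrite !mE //; rewrite /cyc4; do !case: ifP; lia.
Qed.

Lemma cyc4_subm t i w x y z : w < t -> x < t -> y < t -> z < t ->
  cyc4 w x y z ->
  cyc4 ((i + t - z) %% t) ((i + t - y) %% t) ((i + t - x) %% t) ((i + t - w) %% t).
Proof.
move=> wt xt yt zt c; have t0 : 0 < t by lia.
(* Subtraction from i is the flip u -> t-1-u followed by the rotation by i+1. *)
have mE u : u < t -> (i + t - u) %% t = (i.+1 %% t + (t.-1 - u)) %% t.
  by move=> ut; rewrite modnDml; congr (_ %% _); lia.
rewrite !mE //; apply: cyc4_addm; rewrite ?ltn_pmod //; try lia.
by move: c; rewrite /cyc4; lia.
Qed.

(** * Entries of a subset, indexed modulo its size *)

Section Entries.
Variable n : nat.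
Implicit Types (K R : {set 'I_n}) (x y : 'I_n) (i j k : int).

Lemma absz_mod_lt i (t : nat) : 0 < t -> `|(i %% t)%Z| < t.
Proof.
move=> t0; have := modz_ge0 i (d := t); have := @ltz_pmod i t; lia.
Qed.

Lemma entry_in x K j : 0 < #|K| -> entry x K j \in K.
Proof.
by move=> K0; rewrite -mem_enum mem_nth // -cardE absz_mod_lt.
Qed.

Lemma entry_default x y K j : 0 < #|K| -> entry x K j = entry y K j.
Proof.
move=> K0; apply: set_nth_default.
by rewrite -cardE absz_mod_lt.
Qed.

Lemma entry_mod x K i j : (i = j %[mod #|K|%:Z])%Z -> entry x K i = entry x K j.
Proof. by rewrite /entry => ->. Qed.

Lemma entry_nat x K (m : nat) : m < #|K| -> entry x K m%:Z = nth x (enum K) m.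
Proof. by move=> mK; rewrite /entry modz_nat absz_nat modn_small. Qed.

Lemma entry_lt x K (m p : nat) : m < #|K| -> p < #|K| ->
  (entry x K m%:Z < entry x K p%:Z) = (m < p).
Proof.
move=> mK pK; case: (ltngtP m p) => [mp|pm|->]; last by rewrite ltnn.
  by rewrite !entryE // e_lt.
by apply/negbTE; rewrite -leqNgt !entryE // ltnW // e_lt.
Qed.

Lemma entry_natE x K j : 0 < #|K| ->
  exists2 m : nat, m < #|K| & (j = m%:Z %[mod #|K|%:Z])%Z.
Proof.
move=> K0; exists `|(j %% #|K|)%Z|%N.
  exact: absz_mod_lt.
by rewrite gez0_abs ?modz_ge0 ?modz_mod //; lia.
Qed.

Lemma entry_inj x K i j : 0 < #|K| ->
  entry x K i = entry x K j -> (i = j %[mod #|K|%:Z])%Z.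
Proof.
move=> K0; have [m mK im] := entry_natE x i K0; have [p pK jp] := entry_natE x j K0.
rewrite (entry_mod x im) (entry_mod x jp) im jp !entry_nat // => /eqP.
by rewrite nth_uniq ?enum_uniq -?cardE // => /eqP->.
Qed.

Lemma entry_surj x K y : y \in K -> exists2 m : nat, m < #|K| & y = entry x K m%:Z.
Proof.
rewrite -mem_enum => yK; exists (index y (enum K)); first by rewrite cardE index_mem.
by rewrite entry_nat ?nth_index // cardE index_mem.
Qed.

(** * Blocks and steps to the cyclic predecessor *)

Lemma in_block_mod K i j x :
  (i = j %[mod #|K|%:Z])%Z -> in_block K i x = in_block K j x.
Proof.
move=> ij; rewrite /in_block (entry_mod x ij) (@entry_mod x K (i + 1) (j + 1)) //.
by rewrite -modzDml ij modzDml.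
Qed.

Lemma entry_succ_neq x K j : 2 <= #|K| -> entry x K j != entry x K (j + 1).
Proof.
move=> K2; apply/eqP => /(entry_inj (ltnW K2)) /esym /eqP.
rewrite eqz_mod_dvd addrAC subrr add0r dvdz1 absz_nat; lia.
Qed.

(** Both sides of the inequality are clockwise distances from a_j, to x and to a_(j+1), written
    without [%%] so that [lia] can treat them. *)
Lemma in_blockP K j x y : 2 <= #|K| ->
  in_block K j x =
  (((if entry y K j <= x then x - entry y K j else x + n - entry y K j)) <
   ((if entry y K j <= entry y K (j + 1) then entry y K (j + 1) - entry y K j
     else entry y K (j + 1) + n - entry y K j)))%N.
Proof.
move=> K2; have K0 := ltnW K2; rewrite /in_block !(entry_default x y) //.
by rewrite inE !modz_sub ltz_nat.
Qed.

Lemma in_block_entry x K j : 2 <= #|K| -> in_block K j (entry x K j).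
Proof.
move=> K2; rewrite (in_blockP _ _ x K2) leqnn subnn.
have := entry_succ_neq x j K2; rewrite -val_eqE /=.
have := ltn_ord (entry x K j); case: ifP; lia.
Qed.

Lemma in_block_entryE x K i j : 2 <= #|K| ->
  in_block K j (entry x K i) -> (i = j %[mod #|K|%:Z])%Z.
Proof.
move=> K2 b; have K0 := ltnW K2.
have [m mK im] := entry_natE x i K0; have [p pK jp] := entry_natE x j K0.
move: b; rewrite (in_block_mod _ jp) im jp => b; congr (modz (Posz _) _).
apply: block_uniq b => //; rewrite -(in_block_mod _ im); exact: in_block_entry.
Qed.

Lemma in_block_entry_eq K j x y : 2 <= #|K| ->
  in_block K j x -> x \in K -> x = entry y K j.
Proof.
move=> K2 b /(@entry_surj y)[m _ xm]; rewrite {1}xm; apply: entry_mod.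
by apply: (@in_block_entryE y K (Posz m) j K2); rewrite -xm.
Qed.

Lemma Phi_block K R i k j x y : 2 <= #|K| -> #|K| = #|R| ->
  in_block K j x -> Phi K R i k x = entry y R (i + k * j).
Proof.
move=> K2 KR; have [m mK jm] := entry_natE x j (ltnW K2).
rewrite (in_block_mod _ jm) => b; rewrite (PhiE _ _ _ K2 mK b).
rewrite (@entry_default x y) -?KR 1?ltnW //; apply: entry_mod.
by rewrite -KR -modzDmr -modzMmr -jm modzMmr modzDmr.
Qed.

Lemma Phi_entry K R i k j x : 2 <= #|K| -> #|K| = #|R| ->
  Phi K R i k (entry x K j) = entry x R (i + k * j).
Proof. by move=> K2 KR; apply: Phi_block; rewrite ?in_block_entry. Qed.

Lemma block_cover_int K x : 2 <= #|K| -> exists j, in_block K j x.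
Proof. by move=> K2; have [j] := block_cover x K2; exists (Posz (val j)). Qed.

Lemma val_ord_pred x : val (ord_pred x) = if x == 0 :> nat then n.-1 else x.-1.
Proof.
have xn := ltn_ord x; rewrite /=; case: eqP => [->|x0].
  by rewrite add0n modn_small //; lia.
by rewrite (_ : (x + n).-1 = x.-1 + n) ?modnDr ?modn_small //; lia.
Qed.

Lemma in_block_pred K j x y : 2 <= #|K| -> in_block K j x ->
  x != entry y K j -> in_block K j (ord_pred x).
Proof.
move=> K2; rewrite !(in_blockP _ _ y K2) val_ord_pred -val_eqE.
have := ltn_ord x; have := ltn_ord (entry y K j); have := ltn_ord (entry y K (j+1)).
by rewrite /=; do !case: ifP; lia.
Qed.

Lemma in_block_pred_entry K j y : 2 <= #|K| ->
  in_block K j (ord_pred (entry y K (j + 1))).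
Proof.
move=> K2; rewrite (in_blockP _ _ y K2) val_ord_pred.
have := entry_succ_neq y j K2; rewrite -val_eqE.
have := ltn_ord (entry y K j); have := ltn_ord (entry y K (j+1)).
by rewrite /=; do !case: ifP; lia.
Qed.

(** * Recovering K and R from the map *)

Definition starts (f : transf n) : {set 'I_n} :=
  [set x | f x != f (ord_pred x)].
Definition range (f : transf n) : {set 'I_n} := [set f x | x : 'I_n].

(** The value is unchanged inside a block. On entering a new block the index into R moves by k = 1
    or -1, which is nonzero modulo t because t >= 2. *)
Lemma starts_Phi K R i k : coordinates K R k -> starts (Phi K R i k) = K.
Proof.
move=> [t [t2 tn Kt Rt kE]]; have K2 : 2 <= #|K| by rewrite Kt.
have KR : #|K| = #|R| by rewrite Kt.
have R0 : 0 < #|R| by rewrite -KR ltnW.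
apply/setP=> x; rewrite inE; have [j b] := block_cover_int x K2.
have [xj | xj] := eqVneq x (entry x K j); last first.
  rewrite !(@Phi_block K R i k j _ x K2 KR) ?(in_block_pred K2 b xj) // eqxx.
  apply/esym/negbTE; apply: contraNN xj => xK.
  by apply/eqP; apply: in_block_entry_eq b xK.
rewrite {3}xj entry_in 1?ltnW //.
have b' := @in_block_pred_entry K (j - 1) x K2.
rewrite subrK -xj in b'.
rewrite (@Phi_block K R i k j _ x K2 KR) // (@Phi_block K R i k (j - 1) _ x K2 KR) //.
apply/eqP => /(entry_inj R0) /eqP; rewrite eqz_mod_dvd -KR Kt.
rewrite (_ : _ - _ = k)%R; last by ring.
by case: kE => ->; rewrite dvdzE //= dvdn1; case: eqP t2 => // ->.
Qed.

Lemma range_Phi K R i k : coordinates K R k -> range (Phi K R i k) = R.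
Proof.
move=> [t [t2 tn Kt Rt kE]]; have K2 : 2 <= #|K| by rewrite Kt.
have KR : #|K| = #|R| by rewrite Kt.
have R0 : 0 < #|R| by rewrite -KR ltnW.
have kk : (k * k = 1)%R by case: kE => ->.
apply/setP=> y; apply/imsetP/idP => [[x _ ->]|yR].
  have [j b] := block_cover_int x K2.
  by rewrite (Phi_block i k x K2 KR b) entry_in.
have [m _ ym] := @entry_surj y _ _ yR.
(* The index solves i + k j = m, since k k = 1. *)
exists (entry y K (k * (Posz m - i))); first by [].
rewrite Phi_entry // mulrA kk mul1r {1}ym; congr (entry _ _ _); ring.
Qed.

Lemma coordinates_sym K R k : coordinates K R k -> coordinates R K k.
Proof. by case=> t [? ? ? ? ?]; exists t. Qed.

(** * Every Phi(K,R,i,k) lies in P_n *)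

Lemma cyc4_entry x R (m1 m2 m3 m4 : nat) :
    m1 < #|R| -> m2 < #|R| -> m3 < #|R| -> m4 < #|R| ->
  cyc4 (entry x R (Posz m1)) (entry x R (Posz m2)) (entry x R (Posz m3))
    (entry x R (Posz m4)) = cyc4 m1 m2 m3 m4.
Proof. by move=> *; rewrite /cyc4 !entry_lt. Qed.

Lemma in_block_natE K (j : nat) x y : 2 <= #|K| -> j < #|K| ->
  in_block K j x = if j.+1 < #|K| then entry y K j <= x < entry y K j.+1
                   else (x < entry y K (Posz 0)) || (entry y K j <= x).
Proof.
move=> K2 jK; rewrite in_blockE //; have K0 := ltnW K2.
by case: ifP => jS; rewrite !entryE.
Qed.

Lemma in_block_wrap K (j : nat) x y : 2 <= #|K| -> j < #|K| ->
  in_block K j x -> x < entry y K (Posz 0) -> j = #|K|.-1.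
Proof.
move=> K2 jK; rewrite (in_block_natE x y K2 jK); case: ifP => jS; last by lia.
case: j jK jS => [|j] jK jS; first by lia.
have := entry_lt y (ltnW K2) jK; lia.
Qed.

Lemma in_block_mono K (p q : nat) x y z :
    2 <= #|K| -> p < #|K| -> q < #|K| -> in_block K p x -> in_block K q y ->
  entry z K (Posz 0) <= x -> x <= y -> p <= q.
Proof.
move=> K2 pK qK; rewrite (in_block_natE x z K2 pK) (in_block_natE y z K2 qK).
move=> bx by_ ex xy; rewrite leqNgt; apply/negP => qp.
have qS : q.+1 < #|K| by lia.
have : entry z K q.+1 <= entry z K p by rewrite leqNgt entry_lt // -leqNgt.
by move: bx by_; rewrite qS; case: ifP => _; lia.
Qed.

(** Points below a_0 all lie in the last block, numbered t-1; from a_0 on the block number never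
    decreases. Hence the only drop is at a_0 or on closing the cycle. *)
Lemma in_block_cyc4 K (p q r s : nat) w x y z :
    2 <= #|K| -> p < #|K| -> q < #|K| -> r < #|K| -> s < #|K| ->
    in_block K p w -> in_block K q x -> in_block K r y -> in_block K s z ->
    w <= x -> x <= y -> y <= z ->
  cyc4 p q r s.
Proof.
move=> K2 pK qK rK sK bw bx by_ bz wx xy yz.
have := in_block_wrap K2 pK bw; have := in_block_wrap K2 qK bx.
have := in_block_wrap K2 rK by_; have := in_block_wrap K2 sK bz.
move=> /(_ w) hz /(_ w) hy /(_ w) hx /(_ w) hw.
have := @in_block_mono _ _ _ _ _ w K2 pK qK bw bx.
have := @in_block_mono _ _ _ _ _ w K2 qK rK bx by_.
have := @in_block_mono _ _ _ _ _ w K2 rK sK by_ bz.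
have := @in_block_mono _ _ _ _ _ w K2 pK sK bw bz.
rewrite /cyc4; have := ltnP w (entry w K (Posz 0)); have := ltnP x (entry w K (Posz 0)).
have := ltnP y (entry w K (Posz 0)); have := ltnP z (entry w K (Posz 0)).
by do 4!case=> ?; lia.
Qed.

Lemma entry_addn x R i (p : nat) : 0 < #|R| ->
  entry x R (i + p%:Z) =
  entry x R (Posz ((`|(i %% #|R|)%Z| + p) %% #|R|)).
Proof.
move=> R0; apply: entry_mod.
by rewrite -modz_nat modz_mod PoszD gez0_abs ?modz_ge0 ?modzDml //; lia.
Qed.

Lemma entry_subn x R i (p : nat) : p < #|R| ->
  entry x R (i - p%:Z) =
  entry x R (Posz ((`|(i %% #|R|)%Z| + #|R| - p) %% #|R|)).
Proof.
move=> pR; apply: entry_mod.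
have R0 : (0 <= i %% #|R|)%Z%R by rewrite modz_ge0 //; lia.
have E : (Posz (`|(i %% #|R|)%Z| + #|R| - p) = (i %% #|R|)%Z - p%:Z + #|R|%:Z)%R by lia.
by rewrite -modz_nat modz_mod E modzDr modzDml.
Qed.

(** Block numbers follow the cyclic order of the points, and j -> i + k j is a rotation of Z_t for k
    = 1 and a rotated flip for k = -1. *)
Lemma Phi_orient K R i k : coordinates K R k -> Phi K R i k \in orient n.
Proof.
move=> [t [t2 tn Kt Rt kE]]; have K2 : 2 <= #|K| by rewrite Kt.
have R0 : 0 < #|R| by rewrite Rt; lia.
have KR : #|K| = #|R| by rewrite Kt.
rewrite inE; apply/orP; case: kE => ->; [left; apply/OPP | right; apply/ORP];
  move=> w x y z wx xy yz.
all: have [p bp] := block_cover w K2; have [q bq] := block_cover x K2.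
all: have [r br] := block_cover y K2; have [s bs] := block_cover z K2.
all: have c := in_block_cyc4 K2 (ltn_ord p) (ltn_ord q) (ltn_ord r) (ltn_ord s)
  bp bq br bs wx xy yz.
all: rewrite (Phi_block _ _ w K2 KR bp) (Phi_block _ _ w K2 KR bq).
all: rewrite (Phi_block _ _ w K2 KR br) (Phi_block _ _ w K2 KR bs).
all: have iR := absz_mod_lt i R0.
all: have R_ (u : 'I_#|K|) : u < #|R| by rewrite -KR.
- rewrite !mul1r !entry_addn // cyc4_entry ?ltn_pmod //.
  exact: cyc4_addm (iR) (R_ p) (R_ q) (R_ r) (R_ s) c.
- rewrite !mulN1r !entry_subn ?R_ // cyc4_entry ?ltn_pmod //.
  exact: cyc4_subm (R_ p) (R_ q) (R_ r) (R_ s) c.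
Qed.

(** * Coordinates of a non-constant member of P_n *)

Lemma ord_pred_ind (P : 'I_n -> Prop) a : P a ->
  (forall x, x != a -> P (ord_pred x) -> P x) -> forall x, P x.
Proof.
move=> Pa Ppred x.
(* The clockwise distance from a to y; away from a, each predecessor step lowers it by one. *)
pose d y := if a <= y then y - a else y + n - a.
have [N] : exists N, d x < N by exists (d x).+1.
elim: N x => // N IH x dx; have [->//|xa] := eqVneq x a.
apply: Ppred => //; apply: IH; move: dx xa; rewrite /d val_ord_pred -val_eqE /=.
by have := ltn_ord x; have := ltn_ord a; do !case: ifP; lia.
Qed.

(** Walk back from x as long as the value does not change. The walk ends at a start or at a, so a
    map without starts is constant. *)
Lemma value_at_start f a x : exists2 y, (y == a) || (y \in starts f) & f x = f y.
Proof.
move: x; apply: (@ord_pred_ind _ a) => [|x xa [y ya fy]].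
  by exists a; rewrite ?eqxx.
have [xs|] := boolP (x \in starts f); first by exists x; rewrite ?xs ?orbT.
by rewrite inE negbK => /eqP->; exists y.
Qed.

Lemma in_block_const f j x y : 2 <= #|starts f| ->
  in_block (starts f) j x -> f x = f (entry y (starts f) j).
Proof.
move=> K2; move: x; apply: (@ord_pred_ind _ (entry y (starts f) j)) => // x xa IH b.
rewrite -IH; last exact: in_block_pred b xa.
apply/eqP; move: xa; apply: contraNT => fx.
by apply/eqP; apply: in_block_entry_eq => //; rewrite inE.
Qed.

Lemma orient_starts_inj f : f \in orient n -> {in starts f &, injective f}.
Proof.
move=> fo a b; wlog lt_ab : a b / a < b.
  move=> IH as_ bs fab; case: (ltngtP a b) => [ab|ba|/val_inj //]; first exact: IH.
  by apply/esym/IH.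
rewrite !inE -!val_eqE => fa fb /(congr1 val) fab; exfalso.
have pa := val_ord_pred a; have pb := val_ord_pred b; have bn := ltn_ord b.
move: fo pa pb; rewrite inE => /orP[/OPP|/ORP] pf; case: eqP => a0 pa; case: eqP => b0 pb.
1,3,5,7: lia.
(* The values around the cycle are p, v, q, v with p and q different from v, which makes two
   descents. [h1] is in increasing order when a > 0; [h2] is its rotation for a = 0, where the
   predecessor of a is n-1. *)
all: have h1 := pf (ord_pred a) a (ord_pred b) b.
all: have h2 := pf a (ord_pred b) b (ord_pred a).
all: move: h1 h2 fa fb fab; rewrite pa pb /cyc4 /=; lia.
Qed.

Lemma orient_Phi f : 0 < n -> f \in orient n -> ~ (exists c, forall x, f x = c) ->
  exists i k : int,
    coordinates (starts f) (range f) k /\ f = Phi (starts f) (range f) i k.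
Proof.
move=> n0 fo fnc; set K := starts f; set R := range f.
have [K0|[a aK]] := set_0Vmem K.
  case: fnc; exists (f (Ordinal n0)) => x.
  by have [y] := value_at_start f (Ordinal n0) x; rewrite -/K K0 inE orbF => /eqP->.
have RE : R = f @: K.
  apply/setP=> y; apply/imsetP/imsetP => [[x _ ->]|[x _ ->]]; last by exists x.
  by have [z /orP[/eqP->|zK] fz] := value_at_start f a x; [exists a | exists z].
have KR : #|K| = #|R|.
  by rewrite RE card_in_imset //; exact: orient_starts_inj.
have K2 : 2 <= #|K|.
  rewrite KR ltnNge; apply/negP => /card_le1_eqP R1; apply: fnc; exists (f a) => x.
  by apply: R1; apply: imset_f.
have Kn : #|K| <= n by rewrite -[n in _ <= n]card_ord max_card.
(* The map induced on indices: [m j] is the position in R of the value at the j-th start. Its value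
   at 0 becomes the coordinate i. *)
pose m (j : nat) := index (f (entry a K (Posz j))) (enum R).
have fR x : f x \in enum R by rewrite mem_enum imset_f.
have m_lt (j : nat) : m j < #|K| by rewrite KR cardE index_mem.
have mE (j : nat) : f (entry a K (Posz j)) = entry a R (Posz (m j)).
  by rewrite [RHS]entry_nat -?KR // nth_index.
have m_inj (i j : nat) : i < j -> j < #|K| -> m i != m j.
  move=> ij jK; apply/eqP => mij.
  have /orient_starts_inj : f (entry a K i) = f (entry a K j) by rewrite !mE mij.
  rewrite !entry_in 1?ltnW // => /(_ fo isT isT) eij.
  by have := entry_lt a (ltn_trans ij jK) jK; rewrite eij ltnn ij.
have ent_le (i j : nat) : i <= j -> j < #|K| -> entry a K i <= entry a K j.
  by move=> ij jK; rewrite leqNgt entry_lt -?leqNgt //; exact: leq_ltn_trans jK.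
have fE x (j : nat) : j < #|K| -> in_block K j x -> f x = entry a R (Posz (m j)).
  by move=> jK b; rewrite -mE; apply: in_block_const.
have cov x : exists2 j : nat, j < #|K| & in_block K j x.
  by have [j b] := block_cover x K2; exists (val j); first exact: ltn_ord.
have coordE k : k = 1%R \/ k = (-1)%R -> coordinates K R k.
  by move=> ?; exists #|K|; split; rewrite -?KR.
move: (fo); rewrite inE => /orP[/OPP|/ORP] pf.
- have trans (j : nat) : j < #|K| -> m 0 + j = m j %[mod #|K|].
    move: j; apply: cyc4_translation => // w x y z wx xy yz zK.
    have yK := leq_ltn_trans yz zK; have xK := leq_ltn_trans xy yK.
    by rewrite -(@cyc4_entry a R) -?KR // -!mE; apply: pf; apply: ent_le.
  exists (Posz (m 0)), 1%R; split; first by apply: coordE; left.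
  apply/ffunP=> x; have [j jK b] := cov x.
  rewrite (fE x j) // (Phi_block _ _ a K2 KR b) mul1r; apply: entry_mod.
  by rewrite -PoszD !modz_nat -KR trans.
- have refl (j : nat) : j < #|K| -> m j + j = m 0 %[mod #|K|].
    move: j; apply: cyc4_reflection => // w x y z wx xy yz zK.
    have yK := leq_ltn_trans yz zK; have xK := leq_ltn_trans xy yK.
    by rewrite -(@cyc4_entry a R) -?KR // -!mE; apply: pf; apply: ent_le.
  exists (Posz (m 0)), (-1)%R; split; first by apply: coordE; right.
  apply/ffunP=> x; have [j jK b] := cov x.
  rewrite (fE x j) // (Phi_block _ _ a K2 KR b) mulN1r; apply: entry_mod.
  have E : (Posz (m 0%N) = Posz (m j) + Posz j %[mod #|R|])%Z.
    by rewrite -PoszD !modz_nat -KR refl.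
  by rewrite -modzDml E modzDml addrK.
Qed.

(** * Products in coordinates *)

Local Open Scope group_scope.

(** The values of the first factor are the initial points of the blocks of the second, so the affine
    index maps j -> i + k j simply compose. *)
Lemma Phi_mul_Phi K R (S : {set 'I_n}) i k i' k' :
  2 <= #|K| -> #|K| = #|R| -> #|R| = #|S| ->
  Phi K R i k * Phi R S i' k' = Phi K S (i' + k' * i)%R (k' * k)%R.
Proof.
move=> K2 KR RS; apply/ffunP=> x; rewrite transf_mulE.
have [j b] := block_cover_int x K2.
have R2 : 2 <= #|R| by rewrite -KR.
rewrite (Phi_block _ _ x K2 KR b) (Phi_entry _ _ _ _ R2 RS).
rewrite (Phi_block _ _ x K2 (etrans KR RS) b); congr (entry _ _ _); ring.
Qed.

End Entries.

(** * The partner relation and the matching *)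

Section Matching.
Variable n : nat.
Hypothesis n_gt0 : 0 < n.
Implicit Types (K R : {set 'I_n}) (f g h : transf n) (i k : int) (a b c : Pn n).
Local Open Scope group_scope.

Definition block_retraction K : transf n := Phi K K 0 1.

(** Boolean, so that [pick] can search the finite type [Pn n] for a partner. *)
Definition partner f g : bool :=
  [&& range f == starts g, range g == starts f,
      f * g == block_retraction (starts f), g * f == block_retraction (starts g),
      f * g * f == f & g * f * g == g].

Lemma partner_sym f g : partner f g = partner g f.
Proof. by rewrite /partner; do 6!case: (_ == _). Qed.

(** With starts g = range f = starts h, the idempotents agree: g f = h f and f g = f h. Hence g = g
    f g = h f g = h f h = h. *)
Lemma partner_uniq f g h : partner f g -> partner f h -> g = h.
Proof.
move=> /and5P[/eqP fg _ /eqP fgE /eqP gfE /andP[_ /eqP <-]].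
move=> /and5P[/eqP fh _ /eqP fhE /eqP hfE /andP[_ /eqP <-]].
by rewrite gfE -fg fh -hfE -!mulgA fgE fhE.
Qed.

(** As k k = 1, the index maps j -> i + k j and j -> -k i + k j are mutually inverse. *)
Lemma partner_Phi K R i k : coordinates K R k ->
  partner (Phi K R i k) (Phi R K (- k * i)%R k).
Proof.
move=> cK; have cR := coordinates_sym cK.
rewrite /partner !range_Phi ?starts_Phi // !eqxx /=.
have [t [t2 _ Kt Rt kE]] := cK.
have K2 : 2 <= #|K| by rewrite Kt.
have R2 : 2 <= #|R| by rewrite Rt.
have KR : #|K| = #|R| by rewrite Kt.
have kk : (k * k = 1)%R by case: kE => ->.
have E1 : (- k * i + k * i = 0)%R by ring.
have E2 : (i + k * (- k * i) = 0)%R by rewrite mulrA mulrN kk mulN1r subrr.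
by rewrite !Phi_mul_Phi // kk E1 E2 !mulr0 !mulr1 !addr0 !eqxx.
Qed.

Definition constant f : Prop := exists y, forall x, f x = y.

(** A constant f has no starts, whereas the range of g is nonempty as n > 0. *)
Lemma partner_nonconstant f g : partner f g -> ~ constant f.
Proof.
move=> /andP[_ /andP[/eqP gf _]] [c fc].
have : g (Ordinal n_gt0) \in range g by apply: imset_f.
by rewrite gf inE !fc eqxx.
Qed.

(** The default a is returned exactly at the constant maps. *)
Definition matching a : Pn n :=
  odflt a [pick b | partner (Pn_val a) (Pn_val b)].

Lemma matching_partner a b :
  partner (Pn_val a) (Pn_val b) -> matching a = b.
Proof.
rewrite /matching => ab; case: pickP => [c ac|/(_ b)]; last by rewrite ab.
by apply: val_inj; apply: partner_uniq ac ab.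
Qed.

Lemma partnerP a :
  (exists b, partner (Pn_val a) (Pn_val b)) \/
  [/\ constant (Pn_val a) & matching a = a].
Proof.
have [b ab|nob] := pickP (fun b => partner (Pn_val a) (Pn_val b)).
  by left; exists b.
right; split; last by rewrite /matching; case: pickP => // b; rewrite nob.
have [|/existsPn nc] := boolP [exists y, [forall x, Pn_val a x == y]].
  by move=> /existsP[c /forallP ac]; exists c => x; apply/eqP.
have [|i [k [cK aE]]] := orient_Phi n_gt0 (Pn_valP a).
  by move=> [c ac]; have /forallP[] := nc c; move=> x; rewrite ac.
have := partner_Phi i cK; rewrite -aE.
by have := nob (MkPn (Phi_orient (- k * i) (coordinates_sym cK))) => /= ->.
Qed.

(** * Green's relations and preservation of H-classes *)

Lemma greenR_kernel a b x y : greenR a b ->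
  Pn_val a x = Pn_val a y -> Pn_val b x = Pn_val b y.
Proof.
move=> ab axy; have [_ /(_ (or_introl (erefl b)))] := ab b.
by case=> [->|[s ->]]; rewrite ?Pn_mulE axy.
Qed.

(** With maps written on the right, R-related maps have the same kernel, and the starts depend only
    on the kernel. *)
Lemma greenR_starts a b : greenR a b -> starts (Pn_val a) = starts (Pn_val b).
Proof.
move=> ab; have ba : greenR b a by move=> x; split=> /ab.
apply/setP=> x; rewrite !inE; congr negb.
by apply/eqP/eqP; apply: greenR_kernel.
Qed.

Lemma greenL_range a b : greenL a b -> range (Pn_val a) = range (Pn_val b).
Proof.
have sub c d : greenL c d -> range (Pn_val c) \subset range (Pn_val d).
  move=> cd; have [/(_ (or_introl (erefl c))) + _] := cd c.
  case=> [->|[s ->]] //; apply/subsetP=> y /imsetP[x _ ->].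
  by rewrite Pn_mulE imset_f.
move=> ab; apply/eqP; rewrite eqEsubset !sub // => x; split=> /ab //.
Qed.

Lemma greenL_mul a b s t : a = s * b -> b = t * a -> greenL a b.
Proof.
move=> ab ba x; split=> [] [->|[u ->]]; right.
- by exists s.
- by exists (u * s); rewrite {1}ab mulgA.
- by exists t.
- by exists (u * t); rewrite {1}ba mulgA.
Qed.

Lemma greenR_mul a b s t : a = b * s -> b = a * t -> greenR a b.
Proof.
move=> ab ba x; split=> [] [->|[u ->]]; right.
- by exists s.
- by exists (s * u); rewrite {1}ab mulgA.
- by exists t.
- by exists (t * u); rewrite {1}ba mulgA.
Qed.

Lemma partner_inverse a b : partner (Pn_val a) (Pn_val b) -> inverse_of a b.
Proof.
move=> /and5P[_ _ _ _ /andP[/eqP aba /eqP bab]].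
by split; apply: val_inj; rewrite !(valM _ _).
Qed.

Lemma matching_involution : involution_matching matching.
Proof.
move=> a; have [[b ab]|[[c ac] aE]] := partnerP a.
  rewrite (matching_partner ab) (@matching_partner b a) 1?partner_sym //.
  by split=> //; apply: partner_inverse.
rewrite !aE; split=> //.
by split; apply: val_inj; apply/ffunP=> x; rewrite !Pn_mulE !ac.
Qed.

Lemma matching_H_class : H_class_preserving matching.
Proof.
move=> a b [abL abR]; have stE := greenR_starts abR; have raE := greenL_range abL.
have [[a' aa']|[[c ac] aE]] := partnerP a; last first.
  (* The range of b equals that of a, a single point, so the H-class of a constant map is
     trivial. *)
  suff -> : b = a by split.
  apply: val_inj; apply/ffunP=> x.
  have : Pn_val b x \in range (Pn_val a) by rewrite raE imset_f.
  by move=> /imsetP[y _ ->]; rewrite !ac.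
have [[b' bb']|[[c bc] _]] := partnerP b; last first.
  case: (partner_nonconstant aa'); exists c => x.
  have : Pn_val a x \in range (Pn_val b) by rewrite -raE imset_f.
  by move=> /imsetP[y _ ->]; rewrite bc.
rewrite (matching_partner aa') (matching_partner bb').
have [_ a'aa'] := partner_inverse aa'; have [_ b'bb'] := partner_inverse bb'.
move: aa' bb' => /and5P[/eqP ra _ /eqP aa' /eqP a'a _].
move=> /and5P[/eqP rb _ /eqP bb' /eqP b'b _].
(* These idempotents depend only on the starts, respectively the range, which a and b share. *)
have E1 : a * a' = b * b'.
  by apply: val_inj; rewrite !(valM _ _) /= aa' bb' stE.
have E2 : a' * a = b' * b.
  by apply: val_inj; rewrite !(valM _ _) /= a'a b'b -ra -rb raE.
split.
(* a' = a' (a a') = (a' b) b', and symmetrically for b'; the R case expands a' as (a' a) a' = b' (b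
   a'). *)
- apply: (@greenL_mul _ _ (a' * b) (b' * a)).
    by rewrite -[LHS]a'aa' -mulgA E1 mulgA.
  by rewrite -[LHS]b'bb' -mulgA -E1 mulgA.
- apply: (@greenR_mul _ _ (b * a') (a * b')).
    by rewrite -[LHS]a'aa' E2 mulgA.
  by rewrite -[LHS]b'bb' -E2 mulgA.
Qed.

End Matching.

Theorem theorem3p1p2 (n : nat) (hn : (1 <= n)%N) :
  exists inv : Pn n -> Pn n,
    [/\ involution_matching inv,
        H_class_preserving inv
      & forall alpha : Pn n, ~ (exists c, forall x, Pn_val alpha x = c) ->
          (exists (K R : {set 'I_n}) (i k : int),
             coordinates K R k /\ Pn_val alpha = Phi K R i k) /\
          (forall (K R : {set 'I_n}) (i k : int),
             coordinates K R k -> Pn_val alpha = Phi K R i k ->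
             Pn_val (inv alpha) = Phi R K (- k * i)%R k)].
Proof.
exists (@matching n).
split; [exact: matching_involution | exact: matching_H_class |].
move=> alpha nc; split.
  have [i [k []]] := orient_Phi hn (Pn_valP alpha) nc.
  by exists (starts (Pn_val alpha)), (range (Pn_val alpha)), i, k.
(* Any coordinates of alpha yield a partner, and partners are unique, so the rule does not depend on
   the choice of coordinates. *)
move=> K R i k cK aE.
have cR := coordinates_sym cK.
by rewrite (@matching_partner _ _ (MkPn (Phi_orient (- k * i) cR))) // aE partner_Phi.
Qed.
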